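(* Let $n \geq 1$, let $K \subset \mathbb{R}^n$ be a compact convex body with smooth boundary and let $L \subset \mathbb{R}^n$ be a lattice of full rank that is nearly orthogonal. Let $$C_n = \frac{ n \sqrt{n} \left( n+2^{n-1} \right)}{\sqrt{2(n+1)}}$$ and let $[\ ]$ denote the integer part. Then there exist a set $S \subset L$ with $|S| = n+1$ and a translated copy $K' = K + v$ of $K$ (for some $v \in \mathbb{R}^n$) such that $S$ illuminates $K'$ and $$d(S,K') \leq 2 \left( \frac{4}{3} \right)^{\frac{n-1}{2}} \left[ \left( \frac{4}{3} \right)^{\frac{n-1}{2}} \frac{ C_n D(K) }{\|L\|} + 1 \right] \frac{\det(L)}{\|L\|^{n-1}}.$$ If in addition $L$ is well-rounded, then there exist a set $S \subset L$ with $|S| = n+1$ and a translated copy $K' = K+v$ of $K$ such that $S$ illuminates $K'$ and $$d(S,K') \leq 2 \left[ \left( \frac{4}{3} \right)^{\frac{n-1}{2}} \frac{ C_n D(K) }{\|L\|} + 1 \right] \|L\|.$$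
   Context: $\|\cdot\|$ is the Euclidean norm on $\mathbb{R}^n$. A compact convex body is a compact convex subset of $\mathbb{R}^n$ with nonempty interior; $\partial K$ is its boundary and $\mathrm{int}(K)$ its interior. $K$ has smooth boundary if there is a unique support hyperplane to $K$ at each point of $\partial K$. A point $x \in \mathbb{R}^n$ illuminates a point $y \in \partial K$ (with $x \neq y$) if the line segment connecting $x$ and $y$ does not intersect $\mathrm{int}(K)$, but the line containing this segment intersects $\mathrm{int}(K)$. A set $S \subset \mathbb{R}^n$ illuminates $K$ if every $y \in \partial K$ is illuminated by some $x \in S$. For a finite set $S$ that illuminates $K$, the illumination distance is $d(S,K) = \max\{\|x-y\| : x \in S,\ y \in K\}$. The diameter of $K$ is $D(K) = \max\{\|x-y\| : x,y \in K\}$ (invariant under translation). Convention of the source: translated copies of $K$ are identified with $K$, so illuminating $K$ means illuminating some translated copy of $K$; this is written out explicitly in the claim. For a full-rank lattice $L \subset \mathbb{R}^n$, $\det(L)$ is its determinant (the absolute value of the determinant of a basis matrix) and $\|L\| = \min\{\|x\| : x \in L\setminus\{0\}\}$ is its minimal norm. $L$ is well-rounded if it contains $n$ linearly independent vectors of norm $\|L\|$. For an ordered basis $a_1,\dots,a_n$ of $L$ and $1 \leq i \leq n-1$, let $\theta_i \in (0,\pi/2]$ be the angle between $a_{i+1}$ and the subspace $\mathrm{span}_{\mathbb{R}}\{a_1,\dots,a_i\}$. $L$ is (weakly) $\theta$-orthogonal if it has an ordered basis for which $\theta_i \in [\theta,\pi/2]$ for all $1 \leq i \leq n-1$. $L$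 is nearly orthogonal if it is (weakly) $\theta$-orthogonal for some $\theta \in [\pi/3,\pi/2]$, i.e. if it has an ordered basis with $\theta_i \geq \pi/3$ for all $1 \leq i \leq n-1$. *)

(* Defs.v *)
From mathcomp Require Export all_boot all_order all_algebra.
From mathcomp Require Export all_classical all_reals all_analysis.
Export numFieldNormedType.Exports.

Set Implicit Arguments.
Unset Strict Implicit.
Unset Printing Implicit Defensive.

Import Order.TTheory GRing.Theory Num.Theory.

Local Open Scope classical_set_scope.
Local Open Scope ring_scope.

(* The library norm `|x| on 'rV[R]_n is the max norm, hence the explicit
   Euclidean norm below.  Interior, closure and compactness refer to the library
   topology of 'rV[R]_n, which is the usual one (all norms being equivalent). *)

Definition dotp (R : realType) (n : nat) (x y : 'rV[R]_n) : R :=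
  \sum_i x 0 i * y 0 i.

Definition enorm (R : realType) (n : nat) (x : 'rV[R]_n) : R :=
  Num.sqrt (dotp x x).

Definition vangle (R : realType) (n : nat) (x y : 'rV[R]_n) : R :=
  acos (dotp x y / (enorm x * enorm y)).

Definition compact_convex_body (R : realType) (n : nat) (K : set 'rV[R]_n) :=
  [/\ compact K, convex_set (K : set (convex_lmodType 'rV[R]_n)) &
      interior K !=set0].

Definition boundary (R : realType) (n : nat) (K : set 'rV[R]_n) :
    set 'rV[R]_n :=
  closure K `\` interior K.

(* Hyperplanes are compared as sets of points, not through their equations. *)
Definition support_hyperplane (R : realType) (n : nat) (K : set 'rV[R]_n)
    (y : 'rV[R]_n) (H : set 'rV[R]_n) :=
  exists (u : 'rV[R]_n) (c : R),
    [/\ u != 0, H = [set x | dotp u x = c], H y &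
        forall x, K x -> dotp u x <= c].

Definition smooth_boundary (R : realType) (n : nat) (K : set 'rV[R]_n) :=
  forall y, boundary K y -> exists! H, support_hyperplane K y H.

Definition segment (R : realType) (n : nat) (x y : 'rV[R]_n) :
    set 'rV[R]_n :=
  [set (1 - t) *: x + t *: y | t in `[0, 1]%classic].

Definition line (R : realType) (n : nat) (x y : 'rV[R]_n) : set 'rV[R]_n :=
  [set (1 - t) *: x + t *: y | t in setT].

Definition illuminates_point (R : realType) (n : nat) (K : set 'rV[R]_n)
    (x y : 'rV[R]_n) :=
  [/\ x != y, segment x y `&` interior K = set0 &
      line x y `&` interior K !=set0].

Definition illuminates (R : realType) (n : nat) (S K : set 'rV[R]_n) :=
  forall y, boundary K y -> exists2 x, S x & illuminates_point K x y.

(* In the next two definitions the supremum is a maximum when S is finite,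
   K is compact, and both are nonempty. *)
Definition illumination_distance (R : realType) (n : nat)
    (S K : set 'rV[R]_n) : R :=
  sup [set enorm (x - y) | x in S & y in K].

Definition diameter (R : realType) (n : nat) (K : set 'rV[R]_n) : R :=
  sup [set enorm (x - y) | x in K & y in K].

Definition translate (R : realType) (n : nat) (K : set 'rV[R]_n)
    (v : 'rV[R]_n) : set 'rV[R]_n :=
  [set x + v | x in K].

(* The rows of B, in order, are the basis vectors. *)
Definition lattice_basis (R : realType) (n : nat) (L : set 'rV[R]_n)
    (B : 'M[R]_n) :=
  B \in unitmx /\
  L = [set x | exists z : 'I_n -> int, x = \sum_i (z i)%:~R *: row i B].

Definition full_rank_lattice (R : realType) (n : nat) (L : set 'rV[R]_n) :=
  exists B, lattice_basis L B.

(* The value does not depend on the chosen basis: see lattice_detE. *)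
Definition lattice_det (R : realType) (n : nat) (L : set 'rV[R]_n) : R :=
  `|\det (get [set B : 'M[R]_n | lattice_basis L B])|.

(* The infimum is a minimum for a lattice with n > 0. *)
Definition min_norm (R : realType) (n : nat) (L : set 'rV[R]_n) : R :=
  inf [set enorm x | x in L `\ 0].

Definition well_rounded (R : realType) (n : nat) (L : set 'rV[R]_n) :=
  exists W : 'M[R]_n, row_free W /\
    forall i, L (row i W) /\ enorm (row i W) = min_norm L.

(* The angle between a vector and a nonzero subspace is the least angle between
   the vector and a nonzero vector of the subspace. *)
Definition angle_subspace (R : realType) (n : nat) (x : 'rV[R]_n)
    (V : {vspace 'rV[R]_n}) : R :=
  inf [set vangle x y | y in [set y | y \in V /\ y != 0]].

Definition span_rows_before (R : realType) (n : nat) (B : 'M[R]_n)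
    (k : 'I_n) : {vspace 'rV[R]_n} :=
  <<[seq row j B | j : 'I_n <- enum 'I_n & (j < k)%N]>>%VS.

(* Rows are numbered from 0, so row k with 0 < k < n is the basis vector
   a_{k+1} and its angle with the span of the preceding rows is theta_k. *)
Definition weakly_orthogonal (R : realType) (n : nat) (theta : R)
    (L : set 'rV[R]_n) :=
  exists2 B : 'M[R]_n, lattice_basis L B &
    forall k : 'I_n, (0 < k)%N ->
      theta <= angle_subspace (row k B) (span_rows_before B k) <= pi / 2.

Definition nearly_orthogonal (R : realType) (n : nat) (L : set 'rV[R]_n) :=
  exists2 theta : R, pi / 3 <= theta <= pi / 2 & weakly_orthogonal theta L.

Definition illumination_const (R : realType) (n : nat) : R :=
  n%:R * Num.sqrt n%:R * (n%:R + 2 ^+ n.-1) / Num.sqrt (2 * (n%:R + 1)).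

Lemma lattice_basis_change (R : realType) (n : nat) (L : set 'rV[R]_n)
    (B B' : 'M[R]_n) : lattice_basis L B -> lattice_basis L B' ->
  exists Z : 'M[int]_n, B = map_mx intr Z *m B'.
Proof.
move=> [_ LB] [_ LB'].
have /choice[f hf] i : exists z : 'I_n -> int,
    row i B = \sum_j (z j)%:~R *: row j B'.
  have : L (row i B).
    rewrite LB /=; exists (fun j => (j == i)%:Z).
    rewrite (bigD1 i)//= eqxx scale1r big1 ?addr0// => j /negPf ->.
    by rewrite scale0r.
  by rewrite LB'.
exists (\matrix_(i, j) f i j); apply/row_matrixP => i.
rewrite hf row_mul mulmx_sum_row; apply: eq_bigr => j _.
by rewrite !mxE.
Qed.

Lemma lattice_detE (R : realType) (n : nat) (L : set 'rV[R]_n)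
    (B : 'M[R]_n) : lattice_basis L B -> lattice_det L = `|\det B|.
Proof.
move=> hB; rewrite /lattice_det; case: xgetP => [B' _ /= hB'|/(_ B)//].
have [Z eZ] := lattice_basis_change hB hB'.
have [Z' eZ'] := lattice_basis_change hB' hB.
have uB := hB.1; rewrite unitmxE unitfE in uB.
have eB : \det B = (\det Z)%:~R * \det B' by rewrite {1}eZ det_mulmx det_map_mx.
have eB' : \det B' = (\det Z')%:~R * \det B.
  by rewrite {1}eZ' det_mulmx det_map_mx.
have : \det Z * \det Z' = 1.
  apply: (@intr_inj R); rewrite intrM; apply: (mulIf uB).
  by rewrite -mulrA -eB' -eB mul1r.
move=> ZZ'.
have Z'1 : `|\det Z'|%N = 1%N.
  have /eqP := congr1 absz ZZ'; rewrite abszM absz1 muln_eq1.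
  by move=> /andP[_ /eqP].
by rewrite eB' normrM -intr_norm -abszE Z'1 mul1r.
Qed.

(* Main.v *)
(** Let [B] be a basis whose successive angles are at least [pi / 3], and let
    [S] consist of [0] and the [N a_i]. Since
    [|x + y|^2 >= 3/4 max (|x|^2, |y|^2)] when the angle between [x] and the line of
    [y] is at least [pi / 3], the [i]-th coordinate of [x] in [B] is at most
    [(4/3)^((n-1)/2) |x| / |a_i|]. Hence the width of [K] in each coordinate is at
    most [w = (4/3)^((n-1)/2) D(K) / |L|], and a translate of [K] fits in the
    interior of the simplex spanned by [S] as soon as [n w < N]; this
    suffices because [n <= C_n]. The vertices of a simplex containing a smooth
    body in its interior illuminate it: the linear functional supporting the body
    at [y] is larger at some vertex [x] than at [y], and the line through [x] and
    [y] meets the interior because otherwise it would lie in a second support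
    hyperplane at [y]. Finally distances are at most [2 N max |a_i|], where
    [max |a_i|] is controlled by a reverse Hadamard inequality in general, and
    equals [|L|] when [L] is well-rounded. *)

Require Import Defs.
From mathcomp Require Import ring lra.
Import Order.TTheory GRing.Theory Num.Theory.

Set Implicit Arguments.
Unset Strict Implicit.
Unset Printing Implicit Defensive.

Local Open Scope classical_set_scope.
Local Open Scope ring_scope.

(** * Euclidean geometry and angles *)

Section Euclidean.
Context {R : realType} {n : nat}.
Implicit Types (x y z u : 'rV[R]_n) (t : R).

Lemma dotpC x y : dotp x y = dotp y x.
Proof. by apply: eq_bigr => i _; rewrite mulrC. Qed.

Lemma dotpDl x y z : dotp (x + y) z = dotp x z + dotp y z.
Proof. by rewrite /dotp -big_split; apply: eq_bigr => i _; rewrite !mxE mulrDl. Qed.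

Lemma dotpDr x y z : dotp z (x + y) = dotp z x + dotp z y.
Proof. by rewrite dotpC dotpDl !(dotpC z). Qed.

Lemma dotpZl t x y : dotp (t *: x) y = t * dotp x y.
Proof. by rewrite /dotp mulr_sumr; apply: eq_bigr => i _; rewrite !mxE mulrA. Qed.

Lemma dotpZr t x y : dotp x (t *: y) = t * dotp x y.
Proof. by rewrite dotpC dotpZl dotpC. Qed.

Lemma dotpNl x y : dotp (- x) y = - dotp x y.
Proof. by rewrite -scaleN1r dotpZl mulN1r. Qed.

Lemma dotpNr x y : dotp x (- y) = - dotp x y.
Proof. by rewrite dotpC dotpNl dotpC. Qed.

Lemma dotpBl x y z : dotp (x - y) z = dotp x z - dotp y z.
Proof. by rewrite dotpDl dotpNl. Qed.

Lemma dotpBr x y z : dotp z (x - y) = dotp z x - dotp z y.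
Proof. by rewrite dotpDr dotpNr. Qed.

Lemma dot0p x : dotp 0 x = 0.
Proof. by rewrite -(scale0r 0) dotpZl mul0r. Qed.

Lemma dotp0 x : dotp x 0 = 0.
Proof. by rewrite dotpC dot0p. Qed.

Lemma dotp_suml (I : Type) (r : seq I) (P : pred I) (F : I -> 'rV[R]_n) u :
  dotp (\sum_(i <- r | P i) F i) u = \sum_(i <- r | P i) dotp (F i) u.
Proof.
by elim/big_rec2: _ => [|i a b _ <-]; rewrite ?dot0p ?dotpDl.
Qed.

Lemma dotp_sumr (I : Type) (r : seq I) (P : pred I) (F : I -> 'rV[R]_n) u :
  dotp u (\sum_(i <- r | P i) F i) = \sum_(i <- r | P i) dotp u (F i).
Proof. by rewrite dotpC dotp_suml; apply: eq_bigr => i _; rewrite dotpC. Qed.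

Lemma dotp_mulmx x y : dotp x y = (x *m y^T) 0 0.
Proof. by rewrite mxE; apply: eq_bigr => i _; rewrite mxE. Qed.

Lemma dotp_ge0 x : 0 <= dotp x x.
Proof. by apply: sumr_ge0 => i _; rewrite -expr2 sqr_ge0. Qed.

Lemma dotp_eq0 x : (dotp x x == 0) = (x == 0).
Proof.
apply/idP/eqP => [|->]; last by rewrite dotp0.
rewrite psumr_eq0 => [/allP h|i _]; last by rewrite -expr2 sqr_ge0.
apply/rowP => i; have := h i (mem_index_enum _).
by rewrite -expr2 sqrf_eq0 mxE => /eqP.
Qed.

Lemma dotp_gt0 x : (0 < dotp x x) = (x != 0).
Proof. by rewrite lt_def dotp_ge0 andbT dotp_eq0. Qed.

Lemma enorm_ge0 x : 0 <= enorm x.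
Proof. exact: sqrtr_ge0. Qed.

Lemma sqr_enorm x : enorm x ^+ 2 = dotp x x.
Proof. by rewrite sqr_sqrtr ?dotp_ge0. Qed.

Lemma enorm_eq0 x : (enorm x == 0) = (x == 0).
Proof. by rewrite -dotp_eq0 -sqr_enorm sqrf_eq0. Qed.

Lemma enorm_gt0 x : (0 < enorm x) = (x != 0).
Proof. by rewrite lt_def enorm_ge0 andbT enorm_eq0. Qed.

Lemma enorm0 : enorm (0 : 'rV[R]_n) = 0.
Proof. by apply/eqP; rewrite enorm_eq0. Qed.

Lemma enormZ t x : enorm (t *: x) = `|t| * enorm x.
Proof. by rewrite /enorm dotpZl dotpZr mulrA -expr2 sqrtrM ?sqr_ge0// sqrtr_sqr. Qed.

Lemma enormN x : enorm (- x) = enorm x.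
Proof. by rewrite -scaleN1r enormZ normrN1 mul1r. Qed.

Lemma dotp_le_enorm x y : dotp x y <= enorm x * enorm y.
Proof.
have [->|y0] := eqVneq y 0; first by rewrite dotp0 enorm0 mulr0.
have [->|x0] := eqVneq x 0; first by rewrite dot0p enorm0 mul0r.
have px : 0 < enorm x by rewrite enorm_gt0.
have py : 0 < enorm y by rewrite enorm_gt0.
(* The squared norm of [|y| x - |x| y] is [2 |x||y| (|x||y| - <x, y>)]. *)
have := dotp_ge0 (enorm y *: x - enorm x *: y).
rewrite !(dotpBl, dotpBr, dotpZl, dotpZr) -!sqr_enorm (dotpC y x).
set a := enorm x in px *; set b := enorm y in py *; set d := dotp x y => h.
have : 0 <= (a * b) * (2 * (a * b - d)) by lra.
by rewrite pmulr_rge0 ?mulr_gt0// pmulr_rge0// subr_ge0.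
Qed.

Lemma normr_dotp_le x y : `|dotp x y| <= enorm x * enorm y.
Proof.
rewrite ler_norml dotp_le_enorm andbT lerNl -dotpNl.
by rewrite (le_trans (dotp_le_enorm _ _))// enormN.
Qed.

Lemma ler_enormD x y : enorm (x + y) <= enorm x + enorm y.
Proof.
rewrite -(@ler_pXn2r _ 2)// ?nnegrE ?addr_ge0 ?enorm_ge0//.
rewrite sqr_enorm !(dotpDl, dotpDr) (dotpC y x) -!sqr_enorm.
have := dotp_le_enorm x y; lra.
Qed.

Lemma ler_enorm_sum (I : Type) (r : seq I) (P : pred I) (F : I -> 'rV[R]_n) :
  enorm (\sum_(i <- r | P i) F i) <= \sum_(i <- r | P i) enorm (F i).
Proof.
elim/big_ind2: _ => [|a b c d h1 h2|//]; first by rewrite enorm0.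
by rewrite (le_trans (ler_enormD _ _))// lerD.
Qed.

Lemma ratio_dotp_enorm x y : x != 0 -> y != 0 ->
  -1 <= dotp x y / (enorm x * enorm y) <= 1.
Proof.
move=> x0 y0; have xy : 0 < enorm x * enorm y by rewrite mulr_gt0 ?enorm_gt0.
by rewrite -ler_norml normrM normfV (gtr0_norm xy) ler_pdivrMr// mul1r normr_dotp_le.
Qed.

(* With c = cos (pi / 3), the triple angle formula at pi / 3 reads
   (c + 1) (2 c - 1) ^ 2 = 0. *)
Lemma cos_pi3 : cos (pi / 3 : R) = 1 / 2.
Proof.
have pi0 := pi_gt0 R.
have c0 : 0 < cos (pi / 3 : R) by apply: cos_gt0_pihalf; lra.
have h : cos (pi / 3 + pi / 3 + pi / 3 : R) = -1.
  by rewrite -[RHS]cospi; congr cos; field.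
move: h; rewrite !(cosD, sinD); set c := cos _ in c0 *; set s := sin _ => h.
have cs : c ^+ 2 + s ^+ 2 = 1 by exact: cos2Dsin2.
have : (c + 1) * (2 * c - 1) ^+ 2 = 0.
  have -> : (c + 1) * (2 * c - 1) ^+ 2 =
    (c * c - s * s) * c - (s * c + c * s) * s + 1
    + 3 * c * (c ^+ 2 + s ^+ 2 - 1) by ring.
  by rewrite h cs; ring.
move=> /eqP; rewrite mulf_eq0 sqrf_eq0 => /orP[|] /eqP e; lra.
Qed.

(** Cosine decreases on [[0, pi]], so the cosine of the angle is at most [1 / 2]. *)
Lemma vangle_ge_pi3 x y : x != 0 -> y != 0 -> pi / 3 <= vangle x y ->
  2 * dotp x y <= enorm x * enorm y.
Proof.
move=> x0 y0; have xy : 0 < enorm x * enorm y by rewrite mulr_gt0 ?enorm_gt0.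
have q := ratio_dotp_enorm x0 y0; rewrite /vangle.
set r := _ / _ in q * => h.
have rE : dotp x y = r * (enorm x * enorm y) by rewrite /r mulfVK// gt_eqF.
have pi0 := pi_gt0 R.
have : r <= 1 / 2.
  have rK : cos (acos r) = r by rewrite acosK.
  rewrite leNgt -{1}rK -cos_pi3 ltr_cos ?in_itv/= -?leNgt//.
    by rewrite acos_ge0// acos_lepi.
  by apply/andP; split; lra.
by rewrite -(ler_pM2r xy) -rE; lra.
Qed.

(* The angle between x and the line spanned by y is at least pi / 3. *)
Definition steep_pair x y := 2 * `|dotp x y| <= enorm x * enorm y.

Lemma steep_pair0 x : steep_pair x 0.
Proof. by rewrite /steep_pair dotp0 enorm0 normr0 !mulr0. Qed.

Lemma steep_pairC x y : steep_pair x y -> steep_pair y x.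
Proof. by rewrite /steep_pair dotpC (mulrC (enorm x)). Qed.

Lemma steep_pairZ t x y : steep_pair x y -> steep_pair (t *: x) y.
Proof.
rewrite /steep_pair dotpZl enormZ normrM => h.
by rewrite mulrCA -mulrA ler_wpM2l.
Qed.

Lemma steep_pair_sqr x y : steep_pair x y ->
  enorm x ^+ 2 - enorm x * enorm y + enorm y ^+ 2 <= enorm (x + y) ^+ 2.
Proof.
move=> h; rewrite (sqr_enorm (x + y)) !(dotpDl, dotpDr) (dotpC y x) -!sqr_enorm.
have := ler_norm (- dotp x y); rewrite normrN; move: h; rewrite /steep_pair; lra.
Qed.

(** Complete the square: [|x|^2 - |x||y| + |y|^2 = 3/4 |x|^2 + (|y| - |x|/2)^2]. *)
Lemma steep_pair_ge x y : steep_pair x y ->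
  3 / 4 * enorm x ^+ 2 <= enorm (x + y) ^+ 2.
Proof.
move=> /steep_pair_sqr; apply: le_trans.
have := sqr_ge0 (enorm y - enorm x / 2); lra.
Qed.

(** * Steep families of rows: coordinates and Gram determinants *)

Section rows.
Context {m : nat} (A : 'M[R]_(m, n)).
Implicit Types (k : nat) (c : 'I_m -> R).

(** The coefficients are indexed by all rows, so that one [c] serves every prefix in an induction on
    [k]. *)
Definition prefix_comb k c : 'rV[R]_n :=
  \sum_(j < m | (j < k)%N) c j *: row j A.

Definition steep_rows := forall (k : 'I_m) c,
  steep_pair (row k A) (prefix_comb k c).

Lemma prefix_comb0 c : prefix_comb 0 c = 0.
Proof. by rewrite /prefix_comb big1. Qed.

Lemma prefix_combS (k : 'I_m) c :
  prefix_comb k.+1 c = c k *: row k A + prefix_comb k c.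
Proof.
rewrite /prefix_comb (bigD1 k) ?ltnSn//=; congr (_ + _).
by apply: eq_bigl => j; rewrite ltnS [in RHS]ltn_neqAle andbC.
Qed.

Lemma prefix_comb_all c : prefix_comb m c = \sum_j c j *: row j A.
Proof. by apply: eq_bigl => j; rewrite ltn_ord. Qed.

Hypothesis stA : steep_rows.

(** Rows are peeled off from the last one down to row [i]. Each removal costs a factor [3/4], and so
    does separating row [i] from its predecessors, unless it is the first row and has none; at most
    [m - 1] factors are lost. *)
Lemma steep_rows_coord c (i : 'I_m) :
  (3 / 4) ^+ m.-1 * enorm (c i *: row i A) ^+ 2
    <= enorm (\sum_j c j *: row j A) ^+ 2.
Proof.
rewrite -prefix_comb_all.
have ind k : (k <= m)%N -> (i < k)%N ->
    (3 / 4) ^+ k.-1 * enorm (c i *: row i A) ^+ 2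
      <= enorm (prefix_comb k c) ^+ 2.
  elim: k => // k IH km; rewrite ltnS leq_eqVlt => /predU1P[<-|ik] /=.
    rewrite prefix_combS; case: (posnP i) => [->|i0].
      by rewrite expr0 mul1r prefix_comb0 addr0.
    apply: le_trans (steep_pair_ge (steep_pairZ _ (stA _ _))).
    rewrite ler_wpM2r ?sqr_ge0// -(prednK i0) exprS ler_piMr//.
    by rewrite exprn_ile1// ler_pdivrMr// mul1r ler_nat.
  have := prefix_combS (Ordinal km) c => /= ->; rewrite addrC.
  apply: le_trans (steep_pair_ge (steep_pairC (steep_pairZ _ (stA (Ordinal km) c)))).
  rewrite /= -(prednK (leq_ltn_trans (leq0n _) ik)) exprS -mulrA.
  by rewrite ler_wpM2l ?divr_ge0// (prednK (leq_ltn_trans _ ik)) ?IH// ltnW.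
exact: ind.
Qed.

End rows.

(* Subtracting from the last row its orthogonal projection on the others
   makes the Gram matrix block diagonal. *)
Lemma gram_det_ge m (A : 'M[R]_(m, n)) : steep_rows A ->
  (forall i, row i A != 0) ->
  (3 / 4) ^+ m.-1 * \prod_(i < m) enorm (row i A) ^+ 2 <= \det (A *m A^T).
Proof.
elim: m A => [|m IH] A; first by rewrite big_ord0 det_mx00 mulr1.
move: A; rewrite -[m.+1]addn1 => A.
rewrite -[A]vsubmxK; set C := usubmx A; set x := dsubmx A => stA A0.
have rC i : row (lshift 1 i) (col_mx C x) = row i C by rewrite rowKu.
have rx : row (rshift m 0) (col_mx C x) = x by rewrite rowKd row_id.
have stC : steep_rows C.
  move=> k c; have := stA (lshift 1 k) (fun j => if fintype.split j is inl l then c l else 0).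
  rewrite rC; set y := prefix_comb _ _ _ => h; suff <- : y = prefix_comb C k c by [].
  rewrite /y /prefix_comb big_split_ord/= [X in _ + X]big1.
    rewrite addr0; apply: eq_bigr => j _.
    by rewrite -[lshift 1 j]/(unsplit (inl j)) unsplitK /= rC.
  by move=> j _; rewrite -[rshift m j]/(unsplit (inr j)) unsplitK scale0r.
have C0 i : row i C != 0 by rewrite -rC.
have := IH C stC C0; set G := C *m C^T => hG.
(* The induction hypothesis makes the Gram matrix of [C] invertible, so the normal equations of the
   projection can be solved. *)
have Gpos : 0 < \det G.
  apply: lt_le_trans hG; rewrite mulr_gt0 ?exprn_gt0//.
  by apply: prodr_gt0 => i _; rewrite exprn_gt0// enorm_gt0.
have Gu : G \in unitmx by rewrite unitmxE unitfE gt_eqF.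
pose c := x *m C^T *m invmx G; pose y := - (c *m C).
have yC : (x + y) *m C^T = 0.
  by rewrite /y mulmxDl mulNmx -mulmxA -/G /c mulmxKV// subrr.
have -> : \det (col_mx C x *m (col_mx C x)^T) = \det G * enorm (x + y) ^+ 2.
  (* The row operation replacing [x] by [x + y], of determinant 1. *)
  pose T := block_mx 1%:M 0 (- c) (1%:M : 'M[R]_1).
  have dT : \det T = 1 by rewrite det_lblock !det1 mulr1.
  have TA : T *m col_mx C x = col_mx C (x + y).
    by rewrite mul_block_col !mul1mx mul0mx addr0 mulNmx addrC.
  have dE M : \det (T *m M *m T^T) = \det M.
    by rewrite !det_mulmx det_tr dT mul1r mulr1.
  rewrite -[LHS]dE mulmxA TA -mulmxA -trmx_mul TA.
  rewrite tr_col_mx mul_col_row yC det_ublock.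
  by rewrite det_mx11 -dotp_mulmx sqr_enorm.
have -> : \prod_i enorm (row i (col_mx C x)) ^+ 2 =
    (\prod_i enorm (row i C) ^+ 2) * enorm x ^+ 2.
  by rewrite big_split_ord/= big_ord1 rx; under eq_bigr do rewrite rC.
have yE : y = prefix_comb (col_mx C x) m
    (fun j => if fintype.split j is inl l then - c 0 l else 0).
  rewrite /prefix_comb big_split_ord/= [X in _ + X]big1 => [|j].
    rewrite addr0 /y -mulNmx mulmx_sum_row; apply: eq_big => j.
      by rewrite ltn_ord.
    by rewrite -[lshift 1 j]/(unsplit (inl j)) unsplitK /= rC !mxE.
  by rewrite ltnNge leq_addr.
have stxy : steep_pair x y.
  by have := stA (rshift m 0); rewrite rx yE /= addn0; apply.
rewrite mulrA.
(* For [m = 0] there is nothing to project on and no factor is lost, in accordance with the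
   truncated exponent; otherwise the new row costs one factor [3/4]. *)
case: (posnP m) => m0.
  suff -> : y = 0.
    rewrite addr0 ler_wpM2r ?sqr_ge0//; apply: le_trans hG.
    by rewrite ler_wpM2r ?prodr_ge0// => [i _|]; rewrite ?sqr_ge0// m0.
  by rewrite yE; apply: big1 => j; rewrite [X in (_ < X)%N]m0 ltn0.
rewrite (_ : (m + 1).-1 = m.-1.+1); last by rewrite addn1 prednK.
have P0 : 0 <= \prod_(i < m) enorm (row i C) ^+ 2.
  by apply: prodr_ge0 => i _; rewrite sqr_ge0.
move: P0 hG; set P := \prod_(i < m) _ => P0 hG.
have -> : (3 / 4) ^+ m.-1.+1 * P * enorm x ^+ 2 =
    (3 / 4) ^+ m.-1 * P * (3 / 4 * enorm x ^+ 2) by rewrite exprSr; ring.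
rewrite ler_pM ?mulr_ge0 ?exprn_ge0 ?enorm_ge0//.
exact: steep_pair_ge.
Qed.

End Euclidean.

(** * Nearly orthogonal lattices *)

Section Lattice.
Context {R : realType} {n : nat}.
Implicit Types (L : set 'rV[R]_n) (B : 'M[R]_n).

(** A real power, since the exponent may be a half-integer; for [n >= 1] its square is the inverse
    of [(3/4)^(n-1)]. *)
Definition ortho_defect : R := (4 / 3) `^ ((n%:R - 1) / 2).

Lemma ortho_defect_gt0 : 0 < ortho_defect.
Proof. by rewrite powR_gt0// divr_gt0. Qed.

Lemma ortho_defect_sqr : (1 <= n)%N ->
  (3 / 4) ^+ n.-1 * ortho_defect ^+ 2 = 1.
Proof.
move=> n1; rewrite -powR_mulrn ?powR_ge0// /ortho_defect -powRrM.
rewrite (_ : (n%:R - 1) / 2 * 2%:R = n.-1%:R); last first.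
  by rewrite -[in LHS](prednK n1) -natr1; field.
rewrite powR_mulrn ?divr_ge0// -exprMn (_ : 3 / 4 * (4 / 3) = 1) ?expr1n//.
by field.
Qed.

Definition basis_coord B (x : 'rV[R]_n) : 'rV[R]_n := x *m invmx B.

Lemma basis_coordE B x : B \in unitmx ->
  x = \sum_i basis_coord B x 0 i *: row i B.
Proof. by move=> uB; rewrite -mulmx_sum_row mulmxKV. Qed.

Lemma basis_coord_sum B (c : 'I_n -> R) i : B \in unitmx ->
  basis_coord B (\sum_j c j *: row j B) 0 i = c i.
Proof.
move=> uB; rewrite (_ : \sum_j _ = (\row_j c j) *m B).
  by rewrite /basis_coord mulmxK// mxE.
by rewrite mulmx_sum_row; apply: eq_bigr => j _; rewrite mxE.
Qed.

Lemma row_unitmx_neq0 B i : B \in unitmx -> row i B != 0.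
Proof.
move=> uB; apply/eqP => h.
have := basis_coord_sum (fun j => (j == i)%:R) i uB.
rewrite (bigD1 i)//= h scaler0 add0r big1 => [|j /negPf ->].
  by rewrite /basis_coord mul0mx mxE eqxx => /esym/eqP; rewrite oner_eq0.
by rewrite scale0r.
Qed.

(** The angle with a subspace is an infimum, hence bounds the angle with each nonzero combination
    [y] of earlier rows; using it for both [y] and [- y] controls the absolute value of the dot
    product. *)
Lemma nearly_orthogonal_steep L : nearly_orthogonal L ->
  exists2 B, lattice_basis L B & steep_rows B.
Proof.
move=> [th /andP[th1 _]] [B LB hB]; exists B => // k c.
have [k0|k0] := posnP k.
  by rewrite k0 prefix_comb0; exact: steep_pair0.
have x0 : row k B != 0 by apply: row_unitmx_neq0; case: LB.
set y := prefix_comb B k c.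
have [->|y0] := eqVneq y 0; first exact: steep_pair0.
have yV : y \in span_rows_before B k.
  apply: memv_suml => j jk; apply: memvZ; apply: memv_span.
  by apply/mapP; exists j => //; rewrite mem_filter jk mem_enum.
have [/(le_trans th1) hth _] := andP (hB k k0).
have key z : z \in span_rows_before B k -> z != 0 ->
    2 * dotp (row k B) z <= enorm (row k B) * enorm z.
  move=> zV z0; apply: vangle_ge_pi3 => //; apply: le_trans hth _.
  apply: ge_inf; last by exists z.
  by exists 0 => _ [w [wV w0] <-]; rewrite acos_ge0// ratio_dotp_enorm.
rewrite /steep_pair; case: (ger0P (dotp (row k B) y)) => _; first exact: key.
by rewrite -dotpNr -(enormN y) key ?memvN ?oppr_eq0.
Qed.

Lemma basis_coord_le B x i : (1 <= n)%N -> B \in unitmx -> steep_rows B ->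
  `|basis_coord B x 0 i| * enorm (row i B) <= ortho_defect * enorm x.
Proof.
move=> n1 uB stB; have a0 := ortho_defect_gt0.
rewrite -enormZ -(@ler_pXn2r _ 2)// ?nnegrE ?mulr_ge0 ?enorm_ge0 ?(ltW a0)//.
have := steep_rows_coord stB (fun j => basis_coord B x 0 j) i.
rewrite -basis_coordE// (exprMn _ ortho_defect) => h.
rewrite -[leLHS]mul1r -(ortho_defect_sqr n1) mulrAC mulrC ler_wpM2l//.
by rewrite sqr_ge0.
Qed.

Lemma min_norm_le L x : L x -> x != 0 -> min_norm L <= enorm x.
Proof.
move=> Lx /eqP x0; apply: ge_inf; last by exists x.
by exists 0 => _ [w _ <-]; exact: enorm_ge0.
Qed.

Lemma lattice_basis_row L B i : lattice_basis L B -> L (row i B).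
Proof.
move=> [_ ->]; exists (fun j => (j == i)%:Z).
rewrite (bigD1 i)//= eqxx scale1r big1 ?addr0// => j /negPf ->.
by rewrite scale0r.
Qed.

(** A nonzero lattice vector has an integer coordinate of absolute value at least 1, so
    [basis_coord_le] bounds its norm below by that of the shortest row divided by [ortho_defect]. *)
Lemma min_norm_gt0 L B : (1 <= n)%N -> lattice_basis L B -> steep_rows B ->
  0 < min_norm L.
Proof.
move=> n1 LB stB; have a0 := ortho_defect_gt0; have [uB LE] := LB.
have [i _ hi] : exists2 i : 'I_n, true & forall j, enorm (row i B) <= enorm (row j B).
  case: (arg_minP (fun i => enorm (row i B)) (erefl (xpredT (Ordinal n1)))).
  by move=> i _ hi; exists i => // j; exact: hi.
apply: (@lt_le_trans _ _ (enorm (row i B) / ortho_defect)).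
  by rewrite divr_gt0// enorm_gt0 row_unitmx_neq0.
apply: lb_le_inf.
  exists (enorm (row i B)), (row i B) => //; split; first exact: lattice_basis_row.
  exact/eqP/row_unitmx_neq0.
move=> _ [x [Lx /eqP x0] <-]; rewrite ler_pdivrMr// mulrC.
move: Lx; rewrite LE => -[z xE].
have [j zj] : exists j, z j != 0.
  apply: contrapT => h; move/eqP: x0; apply; rewrite xE big1// => j _.
  by have [->|?] := eqVneq (z j) 0; [rewrite scale0r | case: h; exists j].
apply: le_trans (basis_coord_le x j n1 uB stB).
rewrite xE basis_coord_sum//; apply: le_trans (hi j) _.
by rewrite ler_peMl ?enorm_ge0// norm_intr_ge1 ?intr_int ?intr_eq0.
Qed.

(** Reverse Hadamard: [gram_det_ge] bounds the product of all row norms by [ortho_defect * |det B|],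
    and the [n - 1] rows other than [i] have norm at least [min_norm L]. *)
Lemma enorm_row_le_det L B i : (1 <= n)%N -> lattice_basis L B -> steep_rows B ->
  enorm (row i B) <= ortho_defect * (lattice_det L / min_norm L ^+ n.-1).
Proof.
move=> n1 LB stB; have a0 := ortho_defect_gt0; have [uB LE] := LB.
have m0 := min_norm_gt0 n1 LB stB.
rewrite (lattice_detE LB) mulrA ler_pdivlMr ?exprn_gt0//.
apply: (@le_trans _ _ (\prod_j enorm (row j B))).
  rewrite [leRHS](bigD1 i)//= ler_wpM2l ?enorm_ge0//.
  have -> : min_norm L ^+ n.-1 = \prod_(j < n | j != i) min_norm L.
    by rewrite prodr_const cardC1 card_ord.
  apply: ler_prod => j _; rewrite (ltW m0)/= min_norm_le ?row_unitmx_neq0//.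
  exact: lattice_basis_row.
rewrite -(@ler_pXn2r _ 2)// ?nnegrE ?mulr_ge0 ?(ltW a0)//; last first.
  by apply: prodr_ge0 => j _; exact: enorm_ge0.
have := gram_det_ge stB (fun j => row_unitmx_neq0 j uB).
rewrite det_mulmx det_tr -expr2 (exprMn _ ortho_defect) real_normK ?num_real//.
rewrite prodrXl; set P := \prod_j _ => h.
apply: (le_trans _ (ler_wpM2l (sqr_ge0 ortho_defect) h)).
by rewrite mulrA (mulrC (_ ^+ 2)) ortho_defect_sqr// mul1r.
Qed.

(* If x = z a_k + y with a_k the last basis vector occurring in x, the angle
   condition gives |x|^2 >= |z a_k|^2 - |z a_k||y| + |y|^2, and both norms on the
   right are at least |L| unless y = 0; minimality of x forces equalities. *)
Lemma minimal_vector_coord L B (z : 'I_n -> int) (k : nat) (j : 'I_n) :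
  (1 <= n)%N -> lattice_basis L B -> steep_rows B -> (k <= n)%N ->
  enorm (prefix_comb B k (fun i => (z i)%:~R)) = min_norm L ->
  (j < k)%N -> z j != 0 -> enorm (row j B) = min_norm L.
Proof.
move=> n1 LB stB; have m0 := min_norm_gt0 n1 LB stB; have [uB LE] := LB.
elim: k => // k IH kn; pose o := Ordinal kn.
rewrite (prefix_combS B o) /=.
have rowm : min_norm L <= enorm (row o B).
  by rewrite min_norm_le ?row_unitmx_neq0//; exact: lattice_basis_row.
have [zk0|zk0] := eqVneq (z o) 0.
  rewrite zk0 scale0r add0r ltnS leq_eqVlt => h /predU1P[jk|jk] zj.
    by move: zj; rewrite (_ : j = o) ?zk0//; exact: val_inj.
  by apply: IH => //; exact: ltnW.
set y := prefix_comb _ _ _; set m := min_norm L in m0 rowm IH *.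
set s := _ *: _ => xm; have sm : enorm (row o B) <= enorm s.
  by rewrite enormZ ler_peMl ?enorm_ge0// norm_intr_ge1 ?intr_int ?intr_eq0.
have /steep_pair_sqr : steep_pair s y by apply/steep_pairZ/(stB o).
rewrite xm => hst.
have [y0|y0] := eqVneq y 0.
  move: xm; rewrite y0 addr0 => sE; rewrite ltnS leq_eqVlt => /predU1P[jk _|jk].
    by rewrite (_ : j = o); [apply/le_anti; rewrite rowm -sE sm|exact: val_inj].
  (* By independence, [y = 0] makes all earlier coefficients vanish, contradicting [z j != 0]. *)
  have := basis_coord_sum (fun i => if (i < k)%N then (z i)%:~R else 0) j uB.
  under eq_bigr do rewrite (fun_if (fun t => t *: _)) scale0r.
  rewrite -big_mkcond/= -/(prefix_comb B k (fun i => (z i)%:~R)) -/y y0.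
  rewrite /basis_coord mul0mx mxE jk => /esym/eqP.
  by rewrite intr_eq0 => /eqP ->; rewrite eqxx.
have my : m <= enorm y.
  apply: min_norm_le => //; rewrite LE.
  exists (fun i : 'I_n => if (i < k)%N then z i else 0).
  rewrite /y /prefix_comb big_mkcond; apply: eq_bigr => i _.
  by case: ifP; rewrite ?scale0r.
have ms : m <= enorm s := le_trans rowm sm.
have [sE yE] : enorm s = m /\ enorm y = m.
  move: (enorm s) (enorm y) ms my hst => {xm} u v mu mv huv.
  (* The left side is [u^2 - u v + v^2 - m^2], rewritten as a sum of nonnegative terms. *)
  have h : (u - m) * m + (v - m) * m + (u - v) ^+ 2 + (u - m) * (v - m) <= 0 by lra.
  have h1 : 0 <= (u - m) * m by rewrite mulr_ge0 ?subr_ge0 ?(ltW m0).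
  have h2 : 0 <= (v - m) * m by rewrite mulr_ge0 ?subr_ge0 ?(ltW m0).
  have h3 : 0 <= (u - m) * (v - m) by rewrite mulr_ge0 ?subr_ge0.
  have h4 := sqr_ge0 (u - v).
  have /eqP : (u - m) * m = 0 by lra.
  have /eqP : (v - m) * m = 0 by lra.
  by rewrite !mulf_eq0 !(gt_eqF m0) !orbF !subr_eq0 => /eqP-> /eqP->.
rewrite ltnS leq_eqVlt => /predU1P[jk _|jk zj].
  by rewrite (_ : j = o); [apply/le_anti; rewrite rowm -sE sm|exact: val_inj].
by apply: IH => //; exact: ltnW.
Qed.

(** The independent minimal vectors span the space, so one of them has a nonzero [i]-th coordinate,
    and [minimal_vector_coord] applies to it. *)
Lemma well_rounded_row L B i : (1 <= n)%N -> lattice_basis L B ->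
  steep_rows B -> well_rounded L -> enorm (row i B) = min_norm L.
Proof.
move=> n1 LB stB [W [Wf hW]]; have [uB LE] := LB.
have [k /eqP ki] : exists k, basis_coord B (row k W) 0 i <> 0.
  apply: contrapT => h.
  have : col i (W *m invmx B) = 0.
    apply/colP => k; rewrite !mxE; apply: contrapT => h'; apply: h.
    by exists k; rewrite /basis_coord -row_mul !mxE.
  have uW : W *m invmx B \in unitmx by rewrite unitmx_mul unitmx_inv uB -row_free_unit Wf.
  rewrite colE => h'; have : invmx (W *m invmx B) *m (W *m invmx B *m delta_mx i 0) = 0 :> 'cV[R]_n.
    by rewrite h' mulmx0.
  rewrite mulKmx// => /colP/(_ i); rewrite !mxE !eqxx => /eqP.
  by rewrite oner_eq0.
have [LW mW] := hW k; move: LW ki mW; rewrite LE => -[z ->].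
rewrite basis_coord_sum// intr_eq0 => zi zm.
apply: (@minimal_vector_coord _ _ z n) => //.
by rewrite prefix_comb_all.
Qed.

End Lattice.

(** * Illumination of smooth convex bodies *)

Lemma continuous_translation (R : realType) (V : normedModType R) (v : V) :
  continuous (fun x => x + v).
Proof. by move=> x; apply: cvgD; [exact: cvg_id|exact: cvg_cst]. Qed.

Lemma continuous_homothety (R : realType) (V : normedModType R) (p y : V) (s : R) :
  continuous (fun x => p + s *: (x - p) - y).
Proof.
move=> x; apply: cvgB; last exact: cvg_cst.
apply: cvgD; first exact: cvg_cst.
apply: cvgZ; first exact: cvg_cst.
by apply: cvgB; [exact: cvg_id|exact: cvg_cst].
Qed.

Lemma continuous_subZ (R : realType) (V : normedModType R) (h : V -> R) (d : V) :
  continuous h -> continuous (fun w => w - h w *: d).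
Proof.
move=> ch w; apply: cvgB; first exact: cvg_id.
by apply: cvgZ; [exact: ch|exact: cvg_cst].
Qed.

Section Convex.
Context {R : realType} {n : nat}.
Implicit Types (K : set 'rV[R]_n) (x y p u d : 'rV[R]_n).

Lemma dotp_cvg (T : topologicalType) (f g : T -> 'rV[R]_n) (t : T) :
  {for t, continuous f} -> {for t, continuous g} ->
  {for t, continuous (fun z => dotp (f z) (g z))}.
Proof.
move=> cf cg; rewrite /dotp; apply: cvg_big => [|i _]; first exact: add_continuous.
have coord (h : T -> 'rV[R]_n) : {for t, continuous h} ->
    (fun z => h z 0 i) @ t --> h t 0 i.
  by move=> ch; exact: (continuous_comp ch (@coord_continuous _ _ _ 0 i _)).
by apply: cvgM; exact: coord.
Qed.

Lemma dotp_continuousl d : continuous (fun x => dotp x d).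
Proof.
by move=> x; apply: (@dotp_cvg _ id (fun=> d)) => //; exact: cst_continuous.
Qed.

Lemma normr_le_enorm x : `|x| <= enorm x.
Proof.
have [->|/mx_norm_neq0 [i xi]] := eqVneq `|x| 0; first exact: enorm_ge0.
rewrite [`|x|]xi -(@ler_pXn2r _ 2)// ?nnegrE ?enorm_ge0//.
rewrite sqr_enorm real_normK ?num_real// /dotp (bigD1 i.2)//= ord1 -expr2.
by rewrite lerDl sumr_ge0// => j _; rewrite -expr2 sqr_ge0.
Qed.

Lemma compact_sphere : compact [set u : 'rV[R]_n | dotp u u = 1].
Proof.
apply: bounded_closed_compact.
  exists 1; split => // M M1 u /= u1; apply: le_trans (normr_le_enorm u) _.
  by rewrite /enorm u1 sqrtr1 ltW.
apply: (closed_comp (f := fun u => dotp u u) (D := [set 1 : R])) => [u _|].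
  exact: dotp_cvg.
exact: closed_eq.
Qed.

Lemma convex_comb K x y (t : R) : convex_set (K : set (convex_lmodType 'rV[R]_n)) ->
  0 <= t <= 1 -> K x -> K y -> K (t *: x + (1 - t) *: y).
Proof.
move=> cK /andP[t0 t1] Kx Ky; apply: set_mem.
by apply: (cK x y (Itv01 t0 t1)); exact: mem_set.
Qed.

Lemma interior_ballP K p :
  interior K p <-> exists2 e : R, 0 < e & forall v, `|v| < e -> K (p + v).
Proof.
split=> [/nbhs_normP [e /= e0 he]|[e e0 he]].
  exists e => // v ve; apply: he => /=.
  by rewrite opprD addrA subrr sub0r normrN.
suff : \forall z \near p, K z by [].
apply/nbhs_normP; exists e => //= z /=; rewrite distrC => ze.
by rewrite -[z](subrK p) addrC; exact: he.
Qed.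

Lemma interior_shift K p v : interior K p -> exists2 t : R, 0 < t & K (p + t *: v).
Proof.
move=> /interior_ballP [e e0 he]; have v0 : 0 < `|v| + 1 by rewrite ltr_wpDl.
exists (e / (`|v| + 1)); first exact: divr_gt0.
apply: he; rewrite normrZ gtr0_norm ?divr_gt0// mulrAC ltr_pdivrMr//.
by rewrite ltr_pM2l// ltrDl.
Qed.

(** The homothety of centre [x] and ratio [1 - s] sends a ball around [p] inside [K] to a ball
    inside [K] around the new point. *)
Lemma interior_comb K p x (s : R) :
  convex_set (K : set (convex_lmodType 'rV[R]_n)) ->
  interior K p -> K x -> 0 <= s < 1 -> interior K (p + s *: (x - p)).
Proof.
move=> cK /interior_ballP [e e0 he] Kx /andP[s0 s1].
have s1' : 0 < 1 - s by rewrite subr_gt0.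
apply/interior_ballP; exists ((1 - s) * e); first exact: mulr_gt0.
move=> v ve; set q := p + (1 - s)^-1 *: v.
have Kq : K q.
  by apply: he; rewrite normrZ gtr0_norm ?invr_gt0// ltr_pdivrMl.
rewrite (_ : _ + v = s *: x + (1 - s) *: q).
  by apply: convex_comb => //; rewrite s0 ltW.
by rewrite /q; apply/rowP => i; rewrite !mxE; field; rewrite gt_eqF.
Qed.

Lemma cluster_le (T : topologicalType) (F : set_system T) (g : T -> R) (t : T)
  (e : R) : cluster F t -> {for t, continuous g} ->
  F [set z | g z <= e] -> g t <= e.
Proof.
move=> cFt cg Fg; rewrite leNgt; apply/negP => egt.
have /(cFt _ _ Fg)[z [/= ze ez]] : nbhs t [set z | e < g z].
  exact: (cvgr_gt _ cg).
by move: (lt_le_trans ez ze); rewrite ltxx.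
Qed.

(* u points from the point of p + s (K - p) nearest to the line towards the line. *)
Lemma shrunken_line_separation K p y d (s : R) :
  compact_convex_body K -> interior K p -> d != 0 ->
  (forall t : R, ~ interior K (y + t *: d)) -> 0 <= s < 1 ->
  exists u, [/\ dotp u u = 1, dotp u d = 0 &
    forall x, K x -> dotp u (p + s *: (x - p) - y) <= 0].
Proof.
move=> [cK vK _] Kp d0 Kl s01; have d00 : dotp d d != 0 by rewrite dotp_eq0.
(* [P] is the orthogonal projection along [d], so [|P (x - y)|] is the distance from [x] to the
   line. *)
pose e := (dotp d d)^-1 *: d; pose P w := w - dotp w e *: d.
have Pd w : dotp (P w) d = 0.
  by rewrite dotpBl dotpZl dotpZr mulrAC mulVf// mul1r subrr.
pose q x := p + s *: (x - p) - y.
have cq : continuous (P \o q).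
  move=> x; apply: continuous_comp; first exact: continuous_homothety.
  by apply: continuous_subZ; exact: dotp_continuousl.
have [xs /set_mem Kxs xsmin] : exists2 c, c \in K &
    forall t, t \in K -> dotp (P (q c)) (P (q c)) <= dotp (P (q t)) (P (q t)).
  apply: EVT_min_rV => //.
    by exists p; exact: interior_subset.
  by apply: continuous_subspaceT => x; exact: (dotp_cvg (cq x) (cq x)).
set w := P (q xs) in xsmin.
have w0 : w != 0.
  (* At distance zero, a point of the shrunken body, interior to [K], would lie on the line. *)
  apply/eqP => w0; have := interior_comb vK Kp Kxs s01.
  rewrite (_ : p + _ = y + dotp (q xs) e *: d); first exact: Kl.
  by move/eqP: w0; rewrite subr_eq0 => /eqP <-; rewrite /q [RHS]addrC subrK.
have wpos : 0 < dotp w w by rewrite dotp_gt0.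
have wP z : dotp w (P z) = dotp w z.
  by rewrite /P dotpBr dotpZr (_ : dotp w d = 0) ?mulr0 ?subr0//; exact: Pd.
have wqs : dotp w (q xs) = dotp w w by rewrite -wP.
have key x : K x -> 0 <= s * dotp w (x - xs).
  move=> Kx; rewrite leNgt; apply/negP; set c := s * _ => c0.
  pose v := s *: P (x - xs); pose e2 := dotp v v.
  have e20 : 0 <= e2 by exact: dotp_ge0.
  have wv : dotp w v = c.
    by rewrite /v dotpZr wP.
  have ec : 0 < e2 - c by lra.
  (* Moving by this [t] towards [x] changes the squared distance by
     [t (2 c + t e2) = t c (1 + t) < 0], against minimality. *)
  pose t := - c / (e2 - c).
  have tE : t * (e2 - c) = - c by rewrite /t divfK// gt_eqF.
  have t0 : 0 < t by rewrite divr_gt0// oppr_gt0.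
  have t1 : t <= 1 by rewrite ler_pdivrMr// mul1r; lra.
  have Kxt : K (t *: x + (1 - t) *: xs) by apply: convex_comb; rewrite // (ltW t0).
  have := xsmin _ (mem_set Kxt).
  have -> : P (q (t *: x + (1 - t) *: xs)) = w + t *: v.
    rewrite /w /v /P; have -> : q (t *: x + (1 - t) *: xs) = q xs + (t * s) *: (x - xs).
      by apply/rowP => i; rewrite !mxE; ring.
    move: (q xs) (x - xs) => z1 z2; rewrite dotpDl dotpZl.
    by apply/rowP => i; rewrite !mxE; ring.
  have -> (z1 z2 : 'rV[R]_n) : dotp (z1 + t *: z2) (z1 + t *: z2) =
      dotp z1 z1 + t * (2 * dotp z1 z2 + t * dotp z2 z2).
    by rewrite !(dotpDl, dotpDr, dotpZl, dotpZr) (dotpC z2 z1); ring.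
  rewrite wv -/e2 (_ : _ + t * e2 = 2 * c + t * (e2 - c) + t * c); last by ring.
  rewrite tE lerDl pmulr_rge0// => h.
  have : t * c < 0 by rewrite pmulr_rlt0.
  lra.
have w1 : 0 < enorm w by rewrite enorm_gt0.
exists (- (enorm w)^-1 *: w); split.
- rewrite dotpZl dotpZr -sqr_enorm; field; rewrite gt_eqF//.
- by rewrite dotpZl (_ : dotp w d = 0) ?mulr0//; exact: Pd.
- move=> x Kx; rewrite dotpZl mulNr oppr_le0 mulr_ge0 ?invr_ge0 ?(ltW w1)//.
  have -> : p + s *: (x - p) - y = q xs + s *: (x - xs).
    by apply/rowP => i; rewrite !mxE; ring.
  by rewrite dotpDr dotpZr wqs addr_ge0 ?key// ltW.
Qed.

(** The line may touch [K], so copies of [K] shrunk towards [p] are separated from it first; a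
    cluster point of their unit normals works for [K]. *)
Lemma line_separation K p y d : compact_convex_body K -> interior K p ->
  d != 0 -> (forall t : R, ~ interior K (y + t *: d)) ->
  exists u, [/\ u != 0, dotp u d = 0 &
    forall x, K x -> dotp u x <= dotp u y].
Proof.
move=> hK Kp d0 Kl.
pose s (k : nat) : R := 1 - k.+1%:R^-1.
have s01 k : 0 <= s k < 1.
  by rewrite subr_ge0 invf_le1// ler1n/= gtrBl invr_gt0.
have /choice[u hu] k : exists u, [/\ dotp u u = 1, dotp u d = 0 &
    forall x, K x -> dotp u (p + s k *: (x - p) - y) <= 0].
  exact: shrunken_line_separation.
have uF (A : set 'rV[R]_n) : (\forall k \near \oo, A (u k)) -> (u @ \oo) A by [].
have [v [/= v1 cv]] : [set v : 'rV[R]_n | dotp v v = 1] `&` cluster (u @ \oo) !=set0.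
  by apply: compact_sphere; apply: uF; apply: nearW => k; case: (hu k).
exists v; split.
- by apply/eqP => v0; move: v1; rewrite v0 dotp0 => /esym/eqP; rewrite oner_eq0.
- apply/eqP; rewrite eq_le; apply/andP; split.
    apply: (cluster_le cv (@dotp_continuousl d v)).
    by apply: uF; apply: nearW => k /=; case: (hu k) => _ -> _.
  rewrite -oppr_le0 -dotpNr.
  apply: (cluster_le cv (@dotp_continuousl (- d) v)).
  by apply: uF; apply: nearW => k /=; case: (hu k) => _ h _; rewrite dotpNr h oppr0.
- move=> x Kx; rewrite -subr_le0 -dotpBr; apply/ler_addgt0Pl => e e0; rewrite addr0.
  apply: (cluster_le cv (@dotp_continuousl (x - y) v)).
  (* The shrinking costs at most [|x - p| / (k + 1)], which is eventually below [e]. *)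
  apply: uF; near=> k => /=; have [u1 ud uK] := hu k.
  have := uK x Kx.
  have -> : p + s k *: (x - p) - y = (x - y) - k.+1%:R^-1 *: (x - p).
    by apply/rowP => i; rewrite /s !mxE; ring.
  rewrite (dotpBr (x - y)) dotpZr subr_le0 => /le_trans; apply.
  have := dotp_le_enorm (u k) (x - p).
  rewrite {1}/enorm u1 sqrtr1 mul1r => h.
  rewrite ler_pdivrMl//; apply: le_trans h _; rewrite -ler_pdivrMr//.
  apply: (@le_trans _ _ k%:R); last by rewrite ler_nat.
  by near: k; exact: nbhs_infty_ger.
Unshelve. all: by end_near. Qed.

Lemma interior_dotp_lt K p u (c : R) : interior K p -> u != 0 ->
  (forall x, K x -> dotp u x <= c) -> dotp u p < c.
Proof.
move=> Kp u0 hc; have [t t0 /hc] := interior_shift u Kp.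
by rewrite dotpDr dotpZr; apply: lt_le_trans; rewrite ltrDl mulr_gt0// dotp_gt0.
Qed.

(* If the line through x and y missed the interior of K, it would lie in a
   second support hyperplane at y. *)
Lemma smooth_illuminates_point K y x u (c : R) : compact_convex_body K ->
  smooth_boundary K -> boundary K y -> u != 0 -> dotp u y = c ->
  (forall z, K z -> dotp u z <= c) -> c < dotp u x ->
  illuminates_point K x y.
Proof.
move=> hK sK by_ u0 uy uK ux; split.
- by apply/eqP => xy; move: ux; rewrite xy uy ltxx.
(* On the segment the functional is at least [c], whereas it is below [c] on the interior. *)
- rewrite -subset0 => z [[t /=]]; rewrite in_itv/= => /andP[t0 t1] <- /interior_dotp_lt.
  move=> /(_ _ _ u0 uK); rewrite dotpDr !dotpZr uy; apply/negP; rewrite -leNgt.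
  have : 0 <= (1 - t) * (dotp u x - c) by rewrite mulr_ge0 ?subr_ge0 ?(ltW ux).
  lra.
- apply: contrapT => hl; have [cK vK [p Kp]] := hK.
  have d0 : x - y != 0.
    by rewrite subr_eq0; apply/eqP => xy; move: ux; rewrite xy uy ltxx.
  have [|v [v0 vd vK']] := @line_separation K p y (x - y) hK Kp d0.
    move=> t Kt; apply: hl; exists (y + t *: (x - y)); split => //.
    by exists (1 - t) => //; apply/rowP => i; rewrite !mxE; ring.
  have [H [_ HU]] := sK y by_.
  have H1 : H = [set z | dotp u z = c].
    by apply: HU; exists u, c; split.
  have H2 : H = [set z | dotp v z = dotp v y].
    by apply: HU; exists v, (dotp v y); split.
  have : [set z | dotp v z = dotp v y] x.
    by apply/eqP; rewrite -subr_eq0 -dotpBr vd.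
  by rewrite -H2 H1 /= => ux'; move: ux; rewrite ux' ltxx.
Qed.

(** * Translates, boundedness and diameter *)

Lemma interior_translate K v y :
  interior (translate K v) y <-> interior K (y - v).
Proof.
split=> /interior_ballP [e e0 he]; apply/interior_ballP; exists e => // w we.
  have [x Kx xE] := he w we.
  by rewrite (_ : y - v + w = x)// addrAC -xE addrK.
by exists (y - v + w); [exact: he|rewrite addrAC subrK].
Qed.

Lemma illuminates_point_translate K v x y :
  illuminates_point K (x - v) (y - v) -> illuminates_point (translate K v) x y.
Proof.
have E (t : R) : (1 - t) *: (x - v) + t *: (y - v) = (1 - t) *: x + t *: y - v.
  by apply/rowP => i; rewrite !mxE; ring.
move=> [xy sxy lxy]; split.
- by apply: contra_neq xy => ->.
- rewrite -subset0 => _ [[t t01 <-] /interior_translate]; rewrite -E => h.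
  suff : set0 ((1 - t) *: (x - v) + t *: (y - v)) by [].
  by rewrite -sxy; split => //; exists t.
- case: lxy => _ [[t _ <-]]; rewrite E => /interior_translate h.
  by exists ((1 - t) *: x + t *: y); split => //; exists t.
Qed.

Lemma compact_translate K v : compact K -> compact (translate K v).
Proof.
move=> cK; apply: continuous_compact => //; apply: continuous_subspaceT.
exact: continuous_translation.
Qed.

Lemma boundary_translate K v y : compact K ->
  boundary (translate K v) y -> boundary K (y - v).
Proof.
move=> cK [cy iy]; split; last by move=> /interior_translate.
have : closed (translate K v).
  by apply: compact_closed; [exact: norm_hausdorff|exact: compact_translate].
by move=> /closure_id E; move: cy; rewrite -E => -[x Kx <-]; rewrite addrK; exact: subset_closure.
Qed.

Lemma compact_enorm_bounded K : compact K -> exists M : R, forall x, K x -> enorm x <= M.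
Proof.
move=> cK; have [[z Kz]|K0] := pselect (K !=set0); last first.
  by exists 0 => x Kx; case: K0; exists x.
have [||c _ hc] := @EVT_max_rV R n (fun x => dotp x x) K _ cK; first by exists z.
  by apply: continuous_subspaceT => x; exact: dotp_cvg.
by exists (enorm c) => x Kx; rewrite ler_wsqrtr// hc// mem_set.
Qed.

Lemma enorm_le_diameter K x y : compact K -> K x -> K y ->
  enorm (x - y) <= diameter K.
Proof.
move=> cK Kx Ky; apply: ub_le_sup; last by exists x => //; exists y.
have [M hM] := compact_enorm_bounded cK; exists (M + M) => _ [a Ka [b Kb <-]].
by rewrite (le_trans (ler_enormD _ _))// enormN lerD// hM.
Qed.

End Convex.

(** * Lattice simplices *)

Section Simplex.
Context {R : realType} {n : nat}.
Implicit Types (B : 'M[R]_n) (K L : set 'rV[R]_n) (N : R).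

Definition simplex_vertices B N : set 'rV[R]_n :=
  [set 0] `|` [set N *: row j B | j in [set: 'I_n]].

(** Independence of the rows keeps the nonzero vertices distinct. *)
Lemma card_simplex_vertices B N : B \in unitmx -> N != 0 ->
  (simplex_vertices B N #= `I_n.+1)%card.
Proof.
move=> uB N0; apply/eq_cardSP; exists 0; first by left.
have rowN j : N *: row j B <> 0.
  by apply/eqP; rewrite scaler_eq0 negb_or N0 row_unitmx_neq0.
rewrite (_ : _ `\ _ = [set N *: row j B | j in [set: 'I_n]]); last first.
  apply/seteqP; split=> x.
    by move=> [[|//]].
  by move=> [j _ <-]; split; [right; exists j|exact: rowN].
apply: card_eq_trans (card_esym card_II).
apply: inj_card_eq => i j _ _ /(scalerI N0) ij.
apply/eqP; apply: contraT => nij.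
have := basis_coord_sum (fun k => (k == i)%:R - (k == j)%:R : R) i uB.
rewrite (bigD1 i)//= (bigD1 j) 1?eq_sym//= big1 => [|k /andP[/negPf-> /negPf->]].
  rewrite !eqxx (eq_sym j i) !(negPf nij) ij subr0 sub0r scaleN1r scale1r addr0 subrr.
  by rewrite /basis_coord mul0mx mxE => /esym/eqP; rewrite oner_eq0.
by rewrite subrr scale0r.
Qed.

Lemma simplex_vertices_lattice L B (z : int) : lattice_basis L B ->
  simplex_vertices B z%:~R `<=` L.
Proof.
move=> LB x [->|[j _ <-]]; rewrite LB.2.
  by exists (fun=> 0); rewrite big1// => i _; rewrite scale0r.
exists (fun i => if i == j then z else 0).
rewrite (bigD1 j)//= eqxx big1 ?addr0// => i /negPf ->.
by rewrite scale0r.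
Qed.

(** Suppose [b = <u, y>] dominates all vertices. Vertex 0 gives [b >= 0], the others give
    [N b <= s b] with [s < N] the sum of the coordinates of [y], so [b = 0]. Then [b] is a
    positively weighted sum of the nonpositive [<u, row i B>], which all vanish, forcing [u = 0]. *)
Lemma simplex_vertex_above B N y u : B \in unitmx -> u != 0 ->
  (forall i, 0 < basis_coord B y 0 i) -> \sum_i basis_coord B y 0 i < N ->
  exists2 x, simplex_vertices B N x & dotp u y < dotp u x.
Proof.
move=> uB u0 c0 cN; apply: contrapT => h.
have N0 : 0 < N by apply: le_lt_trans cN; apply: sumr_ge0 => i _; exact: ltW.
have hx x : simplex_vertices B N x -> dotp u x <= dotp u y.
  by move=> Sx; rewrite leNgt; apply/negP => ?; apply: h; exists x.
have b0 : 0 <= dotp u y by have := hx 0 (or_introl erefl); rewrite dotp0.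
have hr i : N * dotp u (row i B) <= dotp u y.
  by rewrite -dotpZr; apply: hx; right; exists i.
have yE : dotp u y = \sum_i basis_coord B y 0 i * dotp u (row i B).
  by rewrite {1}(basis_coordE y uB) dotp_sumr; apply: eq_bigr => i _; rewrite dotpZr.
have yle : N * dotp u y <= (\sum_i basis_coord B y 0 i) * dotp u y.
  rewrite {1}yE mulr_sumr mulr_suml ler_sum// => i _.
  by rewrite mulrCA ler_wpM2l// ltW.
have y0 : dotp u y = 0.
  apply/eqP; rewrite eq_le b0 andbT leNgt; apply/negP => yp.
  by move: yle; rewrite ler_pM2r// leNgt cN.
have r0 i : dotp u (row i B) <= 0 by have := hr i; rewrite y0 pmulr_rle0.
have : \sum_i - (basis_coord B y 0 i * dotp u (row i B)) = 0.
  by rewrite sumrN -yE y0 oppr0.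
move/eqP; rewrite psumr_eq0 => [/allP h0|i _]; last first.
  by rewrite oppr_ge0 mulr_ge0_le0// ltW.
move/eqP: u0; apply; apply/eqP; rewrite -dotp_eq0 {2}(basis_coordE u uB).
rewrite dotp_sumr big1// => i _; rewrite dotpZr.
have := h0 i (mem_index_enum _); rewrite /= oppr_eq0 mulf_eq0 gt_eqF//= => /eqP ->.
by rewrite mulr0.
Qed.

Lemma fit_in_simplex K B N (w : R) : (1 <= n)%N -> B \in unitmx -> K !=set0 ->
  (forall i x x', K x -> K x' -> basis_coord B (x - x') 0 i <= w) ->
  n%:R * w < N ->
  exists v, forall x, K x -> (forall i, 0 < basis_coord B (x + v) 0 i) /\
    \sum_i basis_coord B (x + v) 0 i < N.
Proof.
move=> n1 uB [x0 Kx0] hw wN; have n0 : 0 < n%:R :> R by rewrite ltr0n.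
pose m i := inf [set basis_coord B x 0 i | x in K].
(* Half of the slack [N - n w], shared among the coordinates: after the shift they lie in
   [[e, w + e]] and sum to at most [(N + n w) / 2]. *)
pose e := (N - n%:R * w) / (2 * n%:R).
have e0 : 0 < e by rewrite divr_gt0 ?subr_gt0// mulr_gt0.
have coordB x x' i : basis_coord B (x - x') 0 i = basis_coord B x 0 i - basis_coord B x' 0 i.
  by rewrite /basis_coord mulmxBl !mxE.
have mle x i : K x -> m i <= basis_coord B x 0 i.
  move=> Kx; apply: ge_inf; last by exists x.
  exists (basis_coord B x 0 i - w) => _ [x' Kx' <-].
  by have := hw i _ _ Kx Kx'; rewrite coordB; lra.
have mge x i : K x -> basis_coord B x 0 i - w <= m i.
  move=> Kx; apply: lb_le_inf; first by exists (basis_coord B x0 0 i), x0.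
  by move=> _ [x' Kx' <-]; have := hw i _ _ Kx Kx'; rewrite coordB; lra.
exists (\sum_i (e - m i) *: row i B) => x Kx.
have cE i : basis_coord B (x + \sum_i (e - m i) *: row i B) 0 i =
    basis_coord B x 0 i + e - m i.
  by rewrite {1}/basis_coord mulmxDl mxE [X in _ + X]basis_coord_sum// addrA.
split=> [i|]; first by rewrite cE; have := mle x i Kx; lra.
apply: (@le_lt_trans _ _ (\sum_(i < n) (w + e))).
  by apply: ler_sum => i _; rewrite cE; have := mge x i Kx; lra.
rewrite sumr_const card_ord -mulr_natl mulrDr.
have -> : n%:R * e = (N - n%:R * w) / 2 by rewrite /e; field; rewrite gt_eqF.
lra.
Qed.

Lemma simplex_illuminates K B N v : compact_convex_body K -> smooth_boundary K ->
  B \in unitmx ->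
  (forall x, K x -> (forall i, 0 < basis_coord B (x + v) 0 i) /\
    \sum_i basis_coord B (x + v) 0 i < N) ->
  illuminates (simplex_vertices B N) (translate K v).
Proof.
move=> hK sK uB hv y /(boundary_translate (let: And3 c _ _ := hK in c)) by_.
have Ky : K (y - v).
  have [cK _ _] := hK; have /closure_id -> : closed K.
    by apply: compact_closed => //; exact: norm_hausdorff.
  by case: by_.
have [H [[u [c [u0 HE Hy uK]]] _]] := sK _ by_.
have [] := hv _ Ky; rewrite subrK => c0 cN.
have [x Sx ux] := simplex_vertex_above uB u0 c0 cN.
exists x => //; apply: illuminates_point_translate.
apply: (@smooth_illuminates_point _ _ _ _ _ u c) => //; first by move: Hy; rewrite HE.
by move: Hy; rewrite HE /= => <-; rewrite !dotpBr ltrD2r.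
Qed.

(** Vertices and points of the translate all lie in the simplex, hence have norm at most [N M]; the
    triangle inequality gives the factor 2. *)
Lemma simplex_illumination_distance K B N M v : K !=set0 -> B \in unitmx ->
  0 <= M -> (forall i, enorm (row i B) <= M) ->
  (forall x, K x -> (forall i, 0 < basis_coord B (x + v) 0 i) /\
    \sum_i basis_coord B (x + v) 0 i < N) ->
  illumination_distance (simplex_vertices B N) (translate K v) <= 2 * N * M.
Proof.
move=> [x0 Kx0] uB M0 hM hv.
have N0 : 0 < N.
  have [c0] := hv _ Kx0; apply: le_lt_trans; apply: sumr_ge0 => i _; exact: ltW.
apply: ge_sup.
  exists (enorm (0 - (x0 + v))), 0; first by left.
  by exists (x0 + v) => //; exists x0.
move=> _ [x Sx [_ [y Ky <-] <-]]; have [c0 cN] := hv y Ky.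
have xM : enorm x <= N * M.
  case: Sx => [->|[j _ <-]]; first by rewrite enorm0 mulr_ge0// ltW.
  by rewrite enormZ gtr0_norm// ler_wpM2l// ltW.
have yM : enorm (y + v) <= N * M.
  rewrite (basis_coordE (y + v) uB); apply: le_trans (ler_enorm_sum _ _ _) _.
  apply: (@le_trans _ _ (\sum_i basis_coord B (y + v) 0 i * M)).
    by apply: ler_sum => i _; rewrite enormZ gtr0_norm// ler_wpM2l// ltW.
  by rewrite -mulr_suml ler_wpM2r// ltW.
have := ler_enormD x (- (y + v)); rewrite enormN; lra.
Qed.

End Simplex.

(** * Size of the constant and assembly of the theorem *)

Lemma illumination_const_ge (R : realType) (n : nat) : (1 <= n)%N ->
  n%:R <= illumination_const R n.
Proof.
move=> n1; have n0 : 0 < n%:R :> R by rewrite ltr0n.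
have n1' : 1 <= n%:R :> R by rewrite ler1n.
have p1 : 1 <= 2 ^+ n.-1 :> R by rewrite exprn_ege1// ler1n.
have d0 : 0 < Num.sqrt (2 * (n%:R + 1)) :> R by rewrite sqrtr_gt0; lra.
(* As [n + 2^(n-1) >= 2], it suffices that [2 (n + 1) <= 4 n]. *)
rewrite /illumination_const ler_pdivlMr// -mulrA ler_pM2l//.
apply: (@le_trans _ _ (Num.sqrt n%:R * 2)); last first.
  by rewrite ler_wpM2l ?sqrtr_ge0//; lra.
have -> : Num.sqrt n%:R * 2 = Num.sqrt (n%:R * 2 ^+ 2) :> R.
  by rewrite sqrtrM ?ler0n// sqrtr_sqr gtr0_norm.
rewrite ler_wsqrtr//; lra.
Qed.

Theorem corollary1p4 (R : realType) (n : nat) (hn : (1 <= n)%N)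
    (K : set 'rV[R]_n) (hK : compact_convex_body K) (sK : smooth_boundary K)
    (L : set 'rV[R]_n) (hL : full_rank_lattice L) (oL : nearly_orthogonal L) :
  let a : R := (4 / 3) `^ ((n%:R - 1) / 2) in
  let N : R := (Num.floor (a * (illumination_const R n * diameter K
                                / min_norm L) + 1))%:~R in
  (exists (S : set 'rV[R]_n) (v : 'rV[R]_n),
    [/\ S `<=` L, (S #= `I_n.+1)%card, illuminates S (translate K v) &
        illumination_distance S (translate K v)
          <= 2 * a * N * (lattice_det L / min_norm L ^+ n.-1)]) /\
  (well_rounded L ->
   exists (S : set 'rV[R]_n) (v : 'rV[R]_n),
    [/\ S `<=` L, (S #= `I_n.+1)%card, illuminates S (translate K v) &
        illumination_distance S (translate K v) <= 2 * N * min_norm L]).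
Proof.
move=> a N; have [B LB stB] := nearly_orthogonal_steep oL; have [uB _] := LB.
have a0 : 0 < a := ortho_defect_gt0.
have m0 := min_norm_gt0 hn LB stB.
have [cK _ [p /interior_subset Kp]] := hK.
have K0 : K !=set0 by exists p.
have D0 : 0 <= diameter K by rewrite (le_trans (enorm_ge0 (p - p)))// enorm_le_diameter.
pose w := a * (diameter K / min_norm L).
have hw i x x' : K x -> K x' -> basis_coord B (x - x') 0 i <= w.
  move=> Kx Kx'; rewrite /w mulrA ler_pdivlMr//.
  apply: (@le_trans _ _ (a * enorm (x - x'))); last first.
    by rewrite ler_wpM2l ?(ltW a0)// enorm_le_diameter.
  apply: le_trans (basis_coord_le (x - x') i hn uB stB).
  apply: (@le_trans _ _ (`|basis_coord B (x - x') 0 i| * min_norm L)).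
    by rewrite ler_wpM2r ?ler_norm ?(ltW m0).
  rewrite ler_wpM2l// min_norm_le ?row_unitmx_neq0//.
  exact: lattice_basis_row.
have wN : n%:R * w < N.
  have h : n%:R * w <= a * (illumination_const R n * diameter K / min_norm L).
    rewrite /w mulrCA ler_wpM2l ?(ltW a0)// -[leRHS]mulrA.
    by rewrite ler_wpM2r ?illumination_const_ge// divr_ge0// ltW.
  (* The floor of [X + 1] strictly exceeds [X]. *)
  apply: le_lt_trans h _; rewrite -(ltrD2r 1) /N.
  by apply: lt_le_trans (floorD1_gt _) _; rewrite intrD.
have [v hv] := fit_in_simplex hn uB K0 hw wN.
have N0 : N != 0.
  have w0 : 0 <= w by rewrite mulr_ge0 ?divr_ge0 ?(ltW a0) ?(ltW m0).
  by rewrite gt_eqF// (le_lt_trans _ wN)// mulr_ge0.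
have cS := card_simplex_vertices uB N0.
have SL : simplex_vertices B N `<=` L := simplex_vertices_lattice LB.
have il := simplex_illuminates hK sK uB hv.
(* The same vertices and translation serve both claims; only the bound on the row norms differs. *)
split.
  exists (simplex_vertices B N), v; split => //.
  rewrite (_ : 2 * a * N * _ =
    2 * N * (a * (lattice_det L / min_norm L ^+ n.-1))); last by ring.
  have hM i := enorm_row_le_det i hn LB stB.
  apply: simplex_illumination_distance => //.
  exact: le_trans (enorm_ge0 _) (hM (Ordinal hn)).
move=> wr; exists (simplex_vertices B N), v; split => //.
apply: simplex_illumination_distance => //; first exact: ltW.
by move=> i; rewrite (well_rounded_row i hn LB stB wr).
Qed.
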